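(* Every infinite strongly connected directed graph contains at least one of the following as a butterfly minor: $\mathcal{D}(K_{1,\infty})$; $\mathcal{D}(R)$ for an undirected ray $R$; a dominated directed ray.
   Context: $K_{1,\infty}$ is the star with countably infinitely many leaves. A ray is a one-way infinite path. For a graph $G$, $\mathcal{D}(G)$ is the directed graph obtained from $G$ by replacing each edge $uv$ by the two directed edges $(u,v),(v,u)$. A directed graph is strongly connected if for all vertices $u,v$ it contains a directed $u$--$v$ path. An in-arborescence is a directed graph whose underlying undirected graph is a rooted tree, with all edges directed towards the root; an out-arborescence is defined analogously with all edges directed away from the root. An in-ray (out-ray) is an in-arborescence (out-arborescence) whose underlying undirected graph is a ray with its unique vertex of degree $1$ being the root. A dominated directed ray is either the union of an out-ray $R$ with root $r$ and edges $(v,r)$ (tail $v$, head $r$) for all $v\in V(R)\setminus\{r\}$, or the union of an in-ray $R$ with root $r$ and edges $(r,v)$ (tail $r$, head $v$) for all $v\in V(R)\setminus\{r\}$. A tree-like model of a directed graph $H$ in a directed graph $D$ is a map $\mu$ assigning to every edge of $H$ an edge of $D$ and to every vertex of $H$ a subgraph of $D$ such that: $\mu(v)\cap\mu(w)=\emptyset$ for all distinct $v,w\in V(H)$; for every $v\in V(H)$, $\mu(v)$ is the union of an in-arborescence $T_{\mathrm{in}}^{\mu(v)}$ and an out-arborescence $T_{\mathrm{out}}^{\mu(v)}$ which have only their roots in common; for every $e=(u,v)\in E(H)$, the edge $\mu(e)$ has its tail in $T_{\mathrm{out}}^{\mu(u)}$ and its head in $T_{\mathrm{in}}^{\mu(v)}$.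 $H$ is a butterfly minor of $D$ if there is a tree-like model of $H$ in $D$. *)

(* Defs.v *)
From mathcomp Require Import all_boot.
From mathcomp Require Import boolp classical_sets functions cardinality.

Set Implicit Arguments.
Unset Strict Implicit.
Unset Printing Implicit Defensive.

Local Open Scope classical_set_scope.

(* Graphs have no parallel edges and carry their vertex set explicitly, inside
   an ambient type, so that subgraphs of D live in the same type as D.  Under
   the classical axioms of boolp the eqType structure is no restriction: the
   alias {classic T} equips an arbitrary type T with one. *)
Record digraph (V : eqType) := Digraph {
  vertices : set V;
  arcs : set (V * V);
  arcs_vertices : forall u v, arcs (u, v) -> vertices u /\ vertices v }.

(* An edge uv is encoded by the two ordered pairs (u, v) and (v, u).  Loops are
   not excluded here, so that [underlying] is total; trees have none. *)
Record ugraph (V : eqType) := UGraph {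
  uvertices : set V;
  adj : set (V * V);
  adj_sym : forall u v, adj (u, v) -> adj (v, u);
  adj_vertices : forall u v, adj (u, v) -> uvertices u /\ uvertices v }.

Definition edge_rel (V : eqType) (A : set (V * V)) : rel V :=
  [rel u v | (u, v) \in A].

(* x :: p lists the vertices of a path from x to y; directed when A is the arc
   set of a digraph, undirected when A is the adjacency of a ugraph. *)
Definition is_path (V : eqType) (A : set (V * V)) (x : V) (p : seq V) (y : V) :=
  [/\ path (edge_rel A) x p, uniq (x :: p) & last x p = y].

Definition strongly_connected (V : eqType) (D : digraph V) : Prop :=
  forall u v, vertices D u -> vertices D v -> exists p, is_path (arcs D) u p v.

Definition subgraph (V : eqType) (T D : digraph V) : Prop :=
  vertices T `<=` vertices D /\ arcs T `<=` arcs D.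

Definition is_union (V : eqType) (G G1 G2 : digraph V) : Prop :=
  vertices G = vertices G1 `|` vertices G2 /\ arcs G = arcs G1 `|` arcs G2.

Lemma bidirected_subproof (V : eqType) (G : ugraph V) u v :
  adj G (u, v) -> uvertices G u /\ uvertices G v.
Proof. exact: adj_vertices. Qed.

(* The digraph D(G): both ordered pairs of an edge of G become arcs. *)
Definition bidirected (V : eqType) (G : ugraph V) : digraph V :=
  Digraph (@bidirected_subproof V G).

Definition underlying_adj (V : eqType) (D : digraph V) : set (V * V) :=
  [set e | arcs D (e.1, e.2) \/ arcs D (e.2, e.1)].

Lemma underlying_sym (V : eqType) (D : digraph V) u v :
  underlying_adj D (u, v) -> underlying_adj D (v, u).
Proof. by case=> /= ?; [right | left]. Qed.

Lemma underlying_vertices (V : eqType) (D : digraph V) u v :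
  underlying_adj D (u, v) -> vertices D u /\ vertices D v.
Proof. by case=> /= /arcs_vertices []. Qed.

Definition underlying (V : eqType) (D : digraph V) : ugraph V :=
  UGraph (@underlying_sym V D) (@underlying_vertices V D).

Definition uconnected (V : eqType) (G : ugraph V) : Prop :=
  forall u v, uvertices G u -> uvertices G v -> exists p, is_path (adj G) u p v.

(* A closed sequence of distinct vertices of size 1 is a loop, one of size 2 is
   a single edge walked back and forth, and a longer one is a cycle. *)
Definition acyclic (V : eqType) (G : ugraph V) : Prop :=
  forall c : seq V, ucycle (edge_rel (adj G)) c -> size c = 0 \/ size c = 2.

Definition rooted_tree (V : eqType) (G : ugraph V) (r : V) : Prop :=
  [/\ uvertices G r, uconnected G & acyclic G].

(* An arc (u, v) is directed towards the root r when v lies on the tree path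
   from u to r, and away from r when u lies on the tree path from r to v. *)
Definition in_arborescence (V : eqType) (T : digraph V) (r : V) : Prop :=
  rooted_tree (underlying T) r /\
  forall u v, arcs T (u, v) ->
    forall p, is_path (adj (underlying T)) u p r -> v \in u :: p.

Definition out_arborescence (V : eqType) (T : digraph V) (r : V) : Prop :=
  rooted_tree (underlying T) r /\
  forall u v, arcs T (u, v) ->
    forall p, is_path (adj (underlying T)) r p v -> u \in r :: p.

Definition is_ray (V : eqType) (G : ugraph V) : Prop :=
  exists f : nat -> V,
    [/\ injective f,
        uvertices G = range f &
        adj G = range (fun n => (f n, f n.+1)) `|` range (fun n => (f n.+1, f n))].

Definition degree_one (V : eqType) (G : ugraph V) (r : V) : Prop :=
  exists! v, adj G (r, v).

Definition in_ray (V : eqType) (R : digraph V) (r : V) : Prop :=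
  [/\ in_arborescence R r, is_ray (underlying R) & degree_one (underlying R) r].

Definition out_ray (V : eqType) (R : digraph V) (r : V) : Prop :=
  [/\ out_arborescence R r, is_ray (underlying R) & degree_one (underlying R) r].

Definition dominated_directed_ray (V : eqType) (H : digraph V) : Prop :=
  exists (R : digraph V) (r : V),
    vertices H = vertices R /\
    ((out_ray R r /\
      arcs H = arcs R `|` [set (v, r) | v in vertices R `\ r]) \/
     (in_ray R r /\
      arcs H = arcs R `|` [set (r, v) | v in vertices R `\ r])).

Definition star_adj : set (option nat * option nat) :=
  range (fun n => (None, Some n)) `|` range (fun n => (Some n, None)).

Lemma star_sym u v : star_adj (u, v) -> star_adj (v, u).
Proof. by case=> -[n _ [<- <-]]; [right | left]; exists n. Qed.

Lemma star_vertices u v :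
  star_adj (u, v) -> [set: option nat] u /\ [set: option nat] v.
Proof. by []. Qed.

(* K_{1,oo}: the centre is None and the leaves are the Some n. *)
Definition infinite_star : ugraph (option nat) :=
  UGraph star_sym star_vertices.

(* The values of mu_v outside the vertices of H and of mu_e outside the arcs of
   H are irrelevant. *)
Definition tree_like_model (W V : eqType) (H : digraph W) (D : digraph V)
    (mu_v : W -> digraph V) (mu_e : W * W -> V * V) : Prop :=
  [/\ forall v, vertices H v -> subgraph (mu_v v) D,
      forall e, arcs H e -> arcs D (mu_e e),
      forall v w, vertices H v -> vertices H w -> v <> w ->
        vertices (mu_v v) `&` vertices (mu_v w) = set0 &
      exists Tin Tout : W -> digraph V,
        (forall v, vertices H v ->
          is_union (mu_v v) (Tin v) (Tout v) /\
          exists r, [/\ in_arborescence (Tin v) r,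
                        out_arborescence (Tout v) r &
                        vertices (Tin v) `&` vertices (Tout v) = [set r]]) /\
        (forall u v, arcs H (u, v) ->
          vertices (Tout u) (mu_e (u, v)).1 /\
          vertices (Tin v) (mu_e (u, v)).2)].

Definition butterfly_minor (W V : eqType) (H : digraph W) (D : digraph V) : Prop :=
  exists (mu_v : W -> digraph V) (mu_e : W * W -> V * V),
    tree_like_model H D mu_v mu_e.

(* Main.v *)
(** If D contains an out-ray v, call (t, h) a jump when D has a v_t--v_h walk
    with interior off the ray.  If some h is the head of jumps from arbitrarily
    late t, then v_h with all off-ray vertices leading to it without meeting
    the ray is the dominating branch set of a dominated ray, and the rest of v
    is cut into segments each containing such a t.  Otherwise, strong
    connectivity makes jumps cross every position, and greedily chosen longest
    jumps back are disjoint and turn v into D(R).  In-rays are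
    dual.  Without rays, Koenig's argument gives a vertex c of infinite
    out-degree, and, applied once more to the reversed digraph and the
    out-neighbours of c, a path from some x to c together with infinitely many
    out-neighbours of c having disjoint paths to x: a model of D(K_{1,oo})
    whose centre is the x--c path.

    Branch sets are only specified by vertex sets reachable from, respectively
    reaching, their root; spanning arborescences exist by taking shortest
    walks. *)

Require Import Defs.
From mathcomp Require Import all_boot.
From mathcomp Require Import boolp classical_sets functions cardinality.

Set Implicit Arguments.
Unset Strict Implicit.
Unset Printing Implicit Defensive.

Local Open Scope classical_set_scope.

(** * Walks *)

(* [thru E S x y]: a nonempty E-walk from x to y whose interior lies in S. *)
Inductive thru (V : Type) (E : V -> V -> Prop) (S : set V) : V -> V -> Prop :=
| thru1 x y of E x y : thru E S x y
| thruS x z y of E x z & S z & thru E S z y : thru E S x y.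

Definition flip (A B : Type) (E : A -> B -> Prop) x y := E y x.

Definition reach (V : Type) (E : V -> V -> Prop) (S : set V) x y :=
  [/\ S x, S y & x = y \/ thru E S x y].

Section Walks.
Variables (V : Type) (E : V -> V -> Prop).
Implicit Types (S T : set V) (x y z : V).

Lemma thru_sub S T x y : S `<=` T -> thru E S x y -> thru E T x y.
Proof.
move=> ST; elim=> {x y} [x y xy|x z y xz Sz _ IH]; first exact: thru1.
exact: thruS xz (ST _ Sz) IH.
Qed.

Lemma thru_trans S x y z : thru E S x y -> S y -> thru E S y z -> thru E S x z.
Proof.
elim=> {x y} [x y xy|x w y xw Sw _ IH] Sy yz; first exact: thruS xy Sy yz.
exact: thruS xw Sw (IH Sy yz).
Qed.

Lemma thru_flip S x y : thru E S x y -> thru (flip E) S y x.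
Proof.
elim=> {x y} [x y xy|x w y xw Sw _ IH]; first exact: thru1.
elim: IH Sw xw => {y w} [y w yw|y u w yu Su _ IH] Sw xw.
  exact: thruS yw Sw (thru1 _ _).
exact: thruS yu Su (IH Sw xw).
Qed.

Lemma thru_last S x y :
  thru E S x y -> E x y \/ exists z, [/\ S z, thru E S x z & E z y].
Proof.
elim=> {x y} [x y|x w y xw Sw _ [wy|[z [Sz wz zy]]]]; first by left.
  by right; exists w; split=> //; exact: thru1.
by right; exists z; split=> //; exact: thruS xw Sw wz.
Qed.

Lemma thru_head S x y :
  thru E S x y -> E x y \/ exists z, [/\ S z, E x z & thru E S z y].
Proof. by case=> {x y} [x y|x w y]; [left | right; exists w]. Qed.

(** Each interior vertex cuts the walk into the two required pieces. Branch sets defined by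
    reachability thereby contain the walks that witness membership. *)
Lemma thru_interior S x y : thru E S x y ->
  thru E [set z | [/\ S z, thru E S x z & thru E S z y]] x y.
Proof.
elim=> {x y} [x y|x w y xw Sw wy IH]; first exact: thru1.
apply: (@thruS _ _ _ _ w) => //; first by split=> //; exact: thru1.
by apply: thru_sub IH => z [Sz wz zy]; split=> //; exact: thruS xw Sw wz.
Qed.

(** If the walk meets [y], keep only the part after its last visit there. *)
Lemma thru_avoid S x y z :
  thru E S x z -> thru E (S `\ y) x z \/ thru E (S `\ y) y z.
Proof.
elim=> {x z} [x z xz|x w z xw Sw _ [wz|yz]]; [by left; exact: thru1| |by right].
have [wy|wy] := pselect (w = y); first by right; rewrite -{2}wy.
by left; apply: thruS xw _ wz.
Qed.

Lemma reach_flip S x y : reach E S x y -> reach (flip E) S y x.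
Proof.
case=> Sx Sy xy; split=> //.
by case: xy => [->|/thru_flip]; [left | right].
Qed.

Lemma reach_trans S x y z : reach E S x y -> reach E S y z -> reach E S x z.
Proof.
case=> Sx Sy xy [_ Sz yz]; split=> //.
case: xy => [->//|xy]; right.
by case: yz => [<-//|yz]; exact: thru_trans xy Sy yz.
Qed.

Lemma reach_head S x z : reach E S x z -> x = z \/
  exists y, [/\ E x y, (S `\ x) y & reach E (S `\ x) y z].
Proof.
case=> Sx Sz [|xz]; first by left.
have [|nxz] := pselect (x = z); first by left.
right; have {}xz : thru E (S `\ x) x z by case: (thru_avoid x xz).
have Sxz : (S `\ x) z by split=> // /esym.
case: (thru_head xz) => [Exz|[y [Sy Exy yz]]].
  by exists z; split=> //; split=> //; left.
by exists y; split=> //; split=> //; right.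
Qed.

End Walks.

(** * Spanning arborescences *)

Section ParentTree.
Variables (V : eqType) (S : set V) (r : V) (par : V -> V) (d : V -> nat).
Hypothesis Sr : S r.
Hypothesis par_in : forall z, S z -> z <> r -> S (par z) /\ (d (par z) < d z)%N.

(** The rank [d] decreases strictly along these arcs, which rules out cycles and makes every ascent
    end at [r]. The in- and the out-tree orient the same edges, so both rest on one study of
    [tree_adj]. *)
Definition child z y := [/\ S z, z <> r & y = par z].

Lemma child_vertices z y : child z y -> S z /\ S y.
Proof. by case=> Sz zr ->; split=> //; case: (par_in Sz zr). Qed.

Lemma child_lt z y : child z y -> (d y < d z)%N.
Proof. by case=> Sz zr ->; case: (par_in Sz zr). Qed.

Lemma in_tree_subproof u v :
  [set e | child e.1 e.2] (u, v) -> S u /\ S v.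
Proof. exact: child_vertices. Qed.

Definition in_tree : digraph V := Digraph in_tree_subproof.

Lemma out_tree_subproof u v :
  [set e | child e.2 e.1] (u, v) -> S u /\ S v.
Proof. by move=> /child_vertices []. Qed.

Definition out_tree : digraph V := Digraph out_tree_subproof.

Definition tree_adj : set (V * V) := [set e | child e.1 e.2 \/ child e.2 e.1].

Lemma adj_in_tree : adj (underlying in_tree) = tree_adj.
Proof. by []. Qed.

Lemma adj_out_tree : adj (underlying out_tree) = tree_adj.
Proof. by apply/seteqP; split=> -[u v] /= [] ?; [right|left|right|left]. Qed.

Local Notation e := (edge_rel tree_adj).

Lemma tree_edgeP u v : reflect (child u v \/ child v u) (e u v).
Proof. by apply: (iffP idP); rewrite /= ?in_setE // => /set_mem. Qed.

Lemma tree_edge_sym : symmetric e.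
Proof. by move=> u v; apply/tree_edgeP/tree_edgeP => -[]; [right|left|right|left]. Qed.

Lemma tree_path_sym x p y : is_path tree_adj x p y ->
  exists2 q, is_path tree_adj y q x & y :: q =i x :: p.
Proof.
case=> xp up <-.
have E : last x p :: rev (belast x p) = rev (x :: p).
  by rewrite (lastI x p) rev_rcons.
exists (rev (belast x p)); last by rewrite E; exact: mem_rev.
split; last by rewrite -[RHS]/(last x [:: x]) -[in LHS](last_cons x) E rev_cons last_rcons.
  by rewrite rev_path (eq_path (e' := e)) // => u v; rewrite tree_edge_sym.
by rewrite E rev_uniq.
Qed.

(** Walks with repetitions concatenate freely; [shortenP] turns them into paths at the end. *)
Definition linked u v := exists2 p, path e u p & last u p = v.

Lemma linked_trans u v w : linked u v -> linked v w -> linked u w.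
Proof.
move=> [p up pv] [q vq qw]; exists (p ++ q); last by rewrite last_cat pv.
by rewrite cat_path up pv.
Qed.

Lemma linked_root n u : (d u < n)%N -> S u -> linked u r /\ linked r u.
Proof.
elim: n u => // n IH u; rewrite ltnS => un Su.
have [->|ur] := pselect (u = r); first by split; exists [::].
have [Sp dp] := par_in Su ur.
have [pr rp] := IH _ (leq_trans dp un) Sp.
have ep : child u (par u) by [].
split; [apply: linked_trans pr|apply: (linked_trans rp)]; eexists [:: _] => //=;
  rewrite andbT; apply/tree_edgeP; by [left|right].
Qed.

Lemma tree_connected u v : S u -> S v -> exists p, is_path tree_adj u p v.
Proof.
move=> Su Sv.
have [ur _] := linked_root (ltnSn _) Su.
have [_ rv] := linked_root (ltnSn _) Sv.
have [p up <-] := linked_trans ur rv.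
by case: (shortenP up) => q uq qu _; exists q.
Qed.

Lemma argmax_mem (c : seq V) : c <> [::] ->
  exists2 m, m \in c & forall x, x \in c -> (d x <= d m)%N.
Proof.
elim: c => // a [|b c] IH _.
  by exists a; rewrite ?mem_head // => x; rewrite inE => /eqP ->.
have [//|m mc mmax] := IH.
have [am|ma] := leqP (d a) (d m).
  exists m; first by rewrite inE mc orbT.
  by move=> x; rewrite inE => /predU1P[->|/mmax].
exists a; rewrite ?mem_head // => x; rewrite inE => /predU1P[->//|/mmax xm].
exact: leq_trans xm (ltnW ma).
Qed.

Lemma edge_par_max m y : (d y <= d m)%N -> e m y -> y = par m.
Proof.
move=> ym /tree_edgeP[[]//|/child_lt]; by rewrite ltnNge ym.
Qed.

(* Both neighbours on a cycle of a vertex of maximal rank are its parent. *)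
Lemma tree_acyclic c : ucycle e c -> size c = 0 \/ size c = 2.
Proof.
have [->|/eqP c0] := eqVneq c [::]; first by left.
have [m mc mmax] := argmax_mem c0; right.
have [i c' Ec] := rot_to mc.
move: H; rewrite -(rot_ucycle i) -(size_rot i) Ec => /andP[cyc uc].
have {}mmax x : x \in m :: c' -> (d x <= d m)%N.
  by rewrite -Ec mem_rot; exact: mmax.
case: c' {Ec c c0 mc} cyc uc mmax => [|y [//|z c']] /=.
  by rewrite andbT => /tree_edgeP[] /child_lt; rewrite ltnn.
rewrite rcons_path => /and4P[my _ _ zm] /and3P[_ yzc _] mmax.
have yE : y = par m by apply: edge_par_max my; rewrite mmax // !inE eqxx orbT.
have zE : last z c' = par m.
  apply: edge_par_max; last by rewrite tree_edge_sym.
  by rewrite mmax // !inE -in_cons mem_last !orbT.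
by rewrite yE -zE mem_last in yzc.
Qed.

(** A path that has descended from [u] to its child [y] can never ascend again: the first ascent
    would return to the vertex it just came from. So it only visits children, and [r] is not one. *)
Lemma child_path_last u y p : child y u -> path e y p -> uniq (u :: y :: p) ->
  last y p <> r.
Proof.
elim: p u y => [|z p IH] u y [Sy yr uE] /=; first by [].
move=> /andP[/tree_edgeP[[_ _ zE]|zy] zp].
  by rewrite zE -uE !inE eqxx !orbT.
by move=> /andP[_ uy]; apply: (IH y).
Qed.

Lemma par_on_path u p : S u -> u <> r -> is_path tree_adj u p r ->
  par u \in u :: p.
Proof.
move=> Su ur [].
case: p => [//|y p] /= /andP[/tree_edgeP[[_ _ ->]|yu] yp] up; last first.
  by move=> yr; case: (child_path_last yu yp up).
by rewrite !inE eqxx orbT.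
Qed.

Lemma in_tree_arborescence : in_arborescence in_tree r.
Proof.
split; first by split=> //; [exact: tree_connected|exact: tree_acyclic].
by move=> u v [/= Su ur ->] p; exact: par_on_path.
Qed.

Lemma out_tree_arborescence : out_arborescence out_tree r.
Proof.
rewrite /out_arborescence /rooted_tree /uconnected /acyclic adj_out_tree.
split; first by split=> //; [exact: tree_connected|exact: tree_acyclic].
move=> u v [/= Sv vr ->] p /tree_path_sym[q vq <-]; exact: par_on_path.
Qed.

End ParentTree.

Fixpoint layer (V : Type) (E : V -> V -> Prop) (S : set V) (r : V) n z : Prop :=
  if n is m.+1 then exists y, [/\ S y, E z y & layer E S r m y] else z = r.

(** The rank is the length of a shortest walk to [r] inside [S], and the parent is the second vertex
    of such a walk. *)
Lemma spanning_parent (V : eqType) (E : V -> V -> Prop) (S : set V) (r : V) :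
  S r -> (forall z, S z -> z = r \/ thru E S z r) ->
  exists (par : V -> V) (d : V -> nat), forall z, S z -> z <> r ->
    [/\ E z (par z), S (par z) & (d (par z) < d z)%N].
Proof.
move=> Sr Sreach.
have lay z : S z -> exists n, `[< layer E S r n z >].
  move=> Sz; have [->|zr] := Sreach _ Sz; first by exists 0; apply/asboolP.
  have: exists n, layer E S r n z.
    elim: zr Sr => {z Sz} [z y zy|z w y zw Sw _ IH] Sy.
      by exists 1, y.
    by have [n wn] := IH Sy; exists n.+1, w.
  by case=> n zn; exists n; apply/asboolP.
have min z : exists n, S z -> layer E S r n z /\
    forall m, layer E S r m z -> (n <= m)%N.
  have [Sz|] := pselect (S z); last by exists 0.
  case: (ex_minnP (lay _ Sz)) => n /asboolP zn nmin; exists n => _; split=> //.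
  by move=> m zm; apply: nmin; apply/asboolP.
have [d dP] := choice min.
have step z : exists y, S z -> z <> r -> [/\ E z y, S y & (d y < d z)%N].
  have [Sz|] := pselect (S z); last by exists z.
  have [zd _] := dP _ Sz.
  case: (d z) zd => [zr|n [y [Sy zy yn]]]; first by exists z.
  by exists y => _ _; split=> //; rewrite ltnS; case: (dP _ Sy) => _; exact.
by have [par parP] := choice step; exists par, d.
Qed.

(** * Minors from branch sets *)

(** A tree-like model reduced to roots and vertex sets. Plain relations for both digraphs make
    reversal of all arcs a mere [flip]. *)
Definition has_model (W V : Type) (HA : W -> W -> Prop) (E : V -> V -> Prop) :=
  exists (rt : W -> V) (Sin Sout : W -> set V),
  [/\ forall w, Sin w `&` Sout w = [set rt w],
      forall w z, Sin w z -> z = rt w \/ thru E (Sin w) z (rt w),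
      forall w z, Sout w z -> z = rt w \/ thru E (Sout w) (rt w) z,
      forall w w' z, (Sin w `|` Sout w) z -> (Sin w' `|` Sout w') z -> w = w' &
      forall w w', HA w w' -> exists x y, [/\ Sout w x, Sin w' y & E x y]].

(** Reversal exchanges the in- and out-parts; it carries results on out-rays over to in-rays. *)
Lemma has_model_flip (W V : Type) (HA : W -> W -> Prop) (E : V -> V -> Prop) :
  has_model HA (flip E) -> has_model (flip HA) E.
Proof.
case=> rt [Sin [Sout [h1 h2 h3 h4 h5]]]; exists rt, Sout, Sin; split.
- by move=> w; rewrite setIC.
- by move=> w z wz; case: (h3 _ _ wz) => [->|zr]; [left|right; exact: thru_flip zr].
- by move=> w z wz; case: (h2 _ _ wz) => [->|zr]; [left|right; exact: thru_flip zr].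
- by move=> w w' z; rewrite setUC [X in _ -> X _ -> _]setUC; exact: h4.
- by move=> w w' /h5[x [y [? ? ?]]]; exists y, x.
Qed.

Lemma in_arborescence_spanning (V : eqType) (D : digraph V) (S : set V) (r : V) :
  S r -> vertices D r ->
  (forall z, S z -> z = r \/ thru (fun x y => arcs D (x, y)) S z r) ->
  exists T, [/\ in_arborescence T r, vertices T = S & subgraph T D].
Proof.
move=> Sr Dr Sreach; have [par [d parP]] := spanning_parent Sr Sreach.
have par_in z : S z -> z <> r -> S (par z) /\ (d (par z) < d z)%N.
  by move=> Sz zr; case: (parP _ Sz zr).
exists (in_tree par_in); split=> //; first exact: in_tree_arborescence.
split=> [z Sz|[z y] /= [Sz zr ->]]; last by case: (parP _ Sz zr).
have [->//|zr] := pselect (z = r).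
by have [/arcs_vertices[]] := parP _ Sz zr.
Qed.

Lemma out_arborescence_spanning (V : eqType) (D : digraph V) (S : set V) (r : V) :
  S r -> vertices D r ->
  (forall z, S z -> z = r \/ thru (fun x y => arcs D (x, y)) S r z) ->
  exists T, [/\ out_arborescence T r, vertices T = S & subgraph T D].
Proof.
move=> Sr Dr Sreach.
have: forall z, S z -> z = r \/ thru (flip (fun x y => arcs D (x, y))) S z r.
  by move=> z Sz; case: (Sreach _ Sz) => [->|rz]; [left|right; exact: thru_flip rz].
move=> Sflip; have [par [d parP]] := spanning_parent Sr Sflip.
have par_in z : S z -> z <> r -> S (par z) /\ (d (par z) < d z)%N.
  by move=> Sz zr; case: (parP _ Sz zr).
exists (out_tree par_in); split=> //; first exact: out_tree_arborescence.
split=> [z Sz|[y z] /= [Sz zr ->]]; last by case: (parP _ Sz zr).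
have [->//|zr] := pselect (z = r).
by have [/arcs_vertices[]] := parP _ Sz zr.
Qed.

Lemma digraph_union_subproof (V : eqType) (G1 G2 : digraph V) u v :
  (arcs G1 `|` arcs G2) (u, v) ->
  (vertices G1 `|` vertices G2) u /\ (vertices G1 `|` vertices G2) v.
Proof. by case=> /arcs_vertices[]; split; by [left|right]. Qed.

Definition digraph_union (V : eqType) (G1 G2 : digraph V) : digraph V :=
  Digraph (@digraph_union_subproof V G1 G2).

Lemma has_model_butterfly (W V : eqType) (HA : W -> W -> Prop)
    (H : digraph W) (D : digraph V) :
  (forall u, exists v, arcs H (u, v)) ->
  (forall u v, arcs H (u, v) -> HA u v) ->
  has_model HA (fun x y => arcs D (x, y)) -> butterfly_minor H D.
Proof.
move=> Hout HAP [rt [Sin [Sout [rtE inP outP disj arcP]]]].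
have rtS w : (Sin w `&` Sout w) (rt w) by rewrite rtE.
(* A branch set may be a singleton, so membership of its root in [D] must come from an arc: an
   out-arc of [w] yields an arc of [D] leaving [Sout w]. *)
have Drt w : vertices D (rt w).
  have [w' /HAP/arcP[x [y [/outP xw _ xy]]]] := Hout w.
  case: xw xy => [->|rx _] => [/arcs_vertices[]//|].
  by case: (thru_head rx) => [/arcs_vertices[]|[z [_ /arcs_vertices[]]]].
have [Tin TinP] := choice (fun w =>
  in_arborescence_spanning (rtS w).1 (Drt w) (inP w)).
have [Tout ToutP] := choice (fun w =>
  out_arborescence_spanning (rtS w).2 (Drt w) (outP w)).
have TinV w : vertices (Tin w) = Sin w by case: (TinP w).
have ToutV w : vertices (Tout w) = Sout w by case: (ToutP w).
have arcP' (e : W * W) : exists f : V * V, arcs H e ->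
    [/\ Sout e.1 f.1, Sin e.2 f.2 & arcs D f].
  have [He|nHe] := pselect (arcs H e); last first.
    by exists (rt e.1, rt e.1) => /nHe.
  by case: e He => u v /HAP/arcP[x [y ?]]; exists (x, y).
have [mu_e mu_eP] := choice arcP'.
exists (fun w => digraph_union (Tin w) (Tout w)), mu_e; split.
- move=> w _; have [_ _ [iV iA]] := TinP w; have [_ _ [oV oA]] := ToutP w.
  by split; [move=> z [/iV|/oV]|move=> f [/iA|/oA]].
- by move=> e /mu_eP[].
- move=> v w _ _ vw; apply/seteqP; split=> // z /= [].
  by rewrite !TinV !ToutV => /disj h /h.
- exists Tin, Tout; split=> [v _|u v /mu_eP[]]; last by rewrite TinV ToutV.
  split=> //; exists (rt v); split; [by case: (TinP v)|by case: (ToutP v)|].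
  by rewrite TinV ToutV.
Qed.

(** * Rays *)

Definition double_ray_arc (m n : nat) := n = m.+1 \/ m = n.+1.

Definition dominated_ray_arc (m n : nat) := n = m.+1 \/ (n = 0 /\ m <> 0).

Section OutRay.
Variables (V : Type) (E : V -> V -> Prop) (v : nat -> V).
Hypotheses (v_inj : injective v) (v_arc : forall n, E (v n) (v n.+1)).

Let off := ~` range v.

Definition jump t h := thru E off (v t) (v h).

Definition segment (b : nat -> nat) n : set V :=
  [set v k | k in [set k | b n <= k < b n.+1]%N].

Lemma off_v n : ~ off (v n).
Proof. by apply; exists n. Qed.

Lemma ray_thru S i j : (i < j)%N ->
  (forall k, (i < k < j)%N -> S (v k)) -> thru E S (v i) (v j).
Proof.
elim: j => // j IH; rewrite ltnS leq_eqVlt => /predU1P[<- _|ij Sk].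
  exact: thru1.
apply: (@thru_trans _ _ _ _ (v j)); last exact: thru1.
  apply: IH => // k /andP[ik kj]; apply: Sk; by rewrite ik ltnS ltnW.
by apply: Sk; rewrite ij ltnSn.
Qed.

Lemma leq_incr (b : nat -> nat) : (forall n, (b n < b n.+1)%N) ->
  {homo b : m n / (m <= n)%N}.
Proof.
by move=> b_lt; apply: homo_leq => // [j i k|i]; [exact: leq_trans|exact: ltnW].
Qed.

Lemma segment_inj b m n z : (forall n, (b n < b n.+1)%N) ->
  segment b m z -> segment b n z -> m = n.
Proof.
move=> b_lt [k /= /andP[mk km] <-] [l /= /andP[nl ln] /v_inj lk].
move: nl ln; rewrite {}lk => nk kn.
apply/eqP; rewrite eqn_leq; apply/andP; split; rewrite leqNgt; apply/negP => /(leq_incr b_lt).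
  by move=> /leq_trans/(_ mk); rewrite leqNgt kn.
by move=> /leq_trans/(_ nk); rewrite leqNgt km.
Qed.

Lemma segment_thru b n k : (b n <= k < b n.+1)%N ->
  v k = v (b n) \/ thru E (segment b n) (v (b n)) (v k).
Proof.
move=> /andP[nk kn]; move: (nk); rewrite leq_eqVlt => /predU1P[->|lt_nk].
  by left.
right; apply: ray_thru => // l /andP[nl lk]; exists l => //=.
by rewrite ltnW //= (ltn_trans lk).
Qed.

Lemma segment_step b n : (b n < b n.+1)%N ->
  exists2 x, segment b n x & E x (v (b n.+1)).
Proof.
case bc: (b n.+1) => [//|c] nc; exists (v c) => //.
by exists c => //=; rewrite bc -ltnS nc ltnSn.
Qed.

(** Trace the walk backwards from [v 0], remembering the next ray vertex [v h] ahead, with [h <= p].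
    A ray vertex of index at most [p] becomes the new [v h]; from one of larger index, the stretch
    to [v h] is a jump across [p]. *)
Lemma thru_jump p x y : thru E setT x y -> y = v 0 ->
  (exists2 h, (h <= p)%N & thru E off x (v h)) \/
  (exists h t, [/\ (h <= p)%N, (p < t)%N & jump t h]).
Proof.
elim=> {x y} [x y xy yE|x z y xz _ _ IH yE].
  by left; exists 0 => //; apply: thru1; rewrite -yE.
have [[h hp zh]|?] := IH yE; last by right.
have [[a _ az]|offz] := pselect (range v z); last first.
  by left; exists h => //; exact: (@thruS _ _ off _ z).
rewrite -{}az in xz zh; have [ap|pa] := leqP a p.
  by left; exists a => //; exact: thru1.
by right; exists h, a.
Qed.

Lemma jump_across p : thru E setT (v p.+1) (v 0) ->
  exists h t, [/\ (h <= p)%N, (p < t)%N & jump t h].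
Proof.
by move=> /(thru_jump p)/(_ erefl)[[h hp ph]|//]; exists h, p.+1.
Qed.

Lemma dominated_model h :
  (forall N, exists t, (N <= t)%N /\ jump t h) -> has_model dominated_ray_arc E.
Proof.
move=> /choice[g gP].
(* Starting at [h.+1] keeps [v h] off the segments; cutting just after the tail [g (b n)] puts that
   tail in segment [n]. *)
pose b n := iter n (fun N => (g N).+1) h.+1.
have b_lt n : (b n < b n.+1)%N by rewrite ltnS; case: (gP (b n)).
have hb n : (h < b n)%N by elim: n => // n IH; exact: ltn_trans (b_lt n).
have bseg n : segment b n (v (b n)) by exists (b n) => //=; rewrite leqnn b_lt.
pose rt w := if w is n.+1 then v (b n) else v h.
pose hub := [set v h] `|` [set z | off z /\ thru E off z (v h)].
pose Sin w := if w is n.+1 then [set v (b n)] else hub.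
pose Sout w := if w is n.+1 then segment b n else [set v h].
have hubE z : (Sin 0 `|` Sout 0) z -> hub z by case=> // ->; left.
have segE n z : (Sin n.+1 `|` Sout n.+1) z -> segment b n z by case=> // ->.
have hub_seg n z : hub z -> segment b n z -> False.
  move=> + [k /= /andP[bk _] kz]; rewrite -{}kz => -[/v_inj kh|[/off_v//]].
  by move: (leq_trans (hb n) bk); rewrite kh ltnn.
exists rt, Sin, Sout; split.
- move=> [|n]; apply/seteqP; split=> z /=.
  + by case.
  + by move=> ->; split=> //; left.
  + by case.
  + by move=> ->.
- move=> [|n] z /=; last by left.
  case=> [->|[offz zh]]; [by left|right].
  by apply: thru_sub (thru_interior zh) => w [offw _ wh]; right.
- move=> [|n] z /=; first by left.
  by case=> k bk <-; exact: segment_thru.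
- move=> [|m] [|n] z //.
  + by move=> /hubE hz /segE /(hub_seg _ _ hz).
  + by move=> /segE sz /hubE /hub_seg /(_ sz).
  + by move=> /segE mz /segE nz; rewrite (segment_inj b_lt mz nz).
(* Arcs of the out-ray follow [v], the first one from [v h] to [v h.+1], which is [v (b 0)]. An arc
   back to 0 is the first arc of a jump, whose next vertex is already in the hub. *)
- move=> w w' [->{w'}|[->{w'}]].
    case: w => [|n]; first by exists (v h), (v h.+1).
    by have [x nx xn] := segment_step (b_lt n); exists x, (v (b n.+1)).
  case: w => // n _; have [bt th] := gP (b n).
  have nt : segment b n (v (g (b n))) by exists (g (b n)) => //=; rewrite bt ltnSn.
  case: (thru_head th) => [Eth|[z [offz Etz zh]]].
    by exists (v (g (b n))), (v h); split=> //; left.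
  by exists (v (g (b n))), z; split=> //; right.
Qed.

(** Only finitely many heads are at most [p], each with bounded tails, so a maximal tail exists; it
    exceeds [p] because some jump crosses [p]. *)
Lemma longest_jump p : (forall n, thru E setT (v n.+1) (v 0)) ->
  (forall h, exists N, forall t, jump t h -> (t <= N)%N) ->
  exists ht : nat * nat, [/\ (ht.1 <= p)%N, (p < ht.2)%N, jump ht.2 ht.1 &
    forall h t, (h <= p)%N -> jump t h -> (t <= ht.2)%N].
Proof.
move=> back bounded.
have [N Nmax] : exists N, forall h t, (h <= p)%N -> jump t h -> (t <= N)%N.
  elim: p => [|p [N Nmax]].
    by have [N Nmax] := bounded 0; exists N => h t; rewrite leqn0 => /eqP ->; exact: Nmax.
  have [M Mmax] := bounded p.+1; exists (maxn N M) => h t.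
  rewrite leq_eqVlt leq_max => /predU1P[->/Mmax->|hp /(Nmax _ _ hp)->] //.
  by rewrite orbT.
pose P t := `[< exists2 h, (h <= p)%N & jump t h >].
have [h [t [hp pt th]]] := jump_across (back p).
have exP : exists t, P t by exists t; apply/asboolP; exists h.
have ubP s : P s -> (s <= N)%N by move=> /asboolP[k kp]; exact: Nmax.
case: (ex_maxnP exP ubP) => m /asboolP[k kp mk] mmax; exists (k, m); split=> //=.
  by apply: (leq_trans pt); apply: mmax; apply/asboolP; exists h.
by move=> l s lp sl; apply: mmax; apply/asboolP; exists l.
Qed.

(* Greedily chosen longest jumps t_{n+1} -> b_n satisfy
   b_n <= t_n < b_{n+1}, and by maximality their interiors are disjoint. *)
Lemma double_ray_model : (forall n, thru E setT (v n.+1) (v 0)) ->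
  (forall h, exists N, forall t, jump t h -> (t <= N)%N) ->
  has_model double_ray_arc E.
Proof.
move=> back bounded.
have [F FP] := choice (fun p => longest_jump p back bounded).
pose t n := iter n (fun p => (F p).2) 0.
pose b n := (F (t n)).1.
have bt n : (b n <= t n)%N by case: (FP (t n)).
have t_lt n : (t n < t n.+1)%N by case: (FP (t n)).
have tjump n : jump (t n.+1) (b n) by case: (FP (t n)).
have tmax n h s : (h <= t n)%N -> jump s h -> (s <= t n.+1)%N.
  by case: (FP (t n)) => _ _ _; exact.
(* If [b n.+1] were at most [t n], the jump from [t n.+2] would have competed in the choice of
   [t n.+1] and beaten it. *)
have tb n : (t n < b n.+1)%N.
  rewrite ltnNge; apply/negP => /tmax/(_ (tjump n.+1)).
  by rewrite leqNgt t_lt.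
have b_lt n : (b n < b n.+1)%N := leq_ltn_trans (bt n) (tb n).
have t_le := leq_incr t_lt.
(* Jump interiors belong to the branch set of their tail. Branch set 0 has no predecessor to jump
   back to, hence the empty set. *)
pose J n : set V := if n is m.+1 then
  [set z | [/\ off z, thru E off (v (t m.+1)) z & thru E off z (v (b m))]]
  else set0.
have Joff n z : J n z -> off z by case: n => // n [].
(* A vertex shared by [J m.+1] and [J n.+1] with [m < n] would splice a jump from [t n.+1] to [b m],
   against the maximality of [t m.+1]. *)
have J_le m n z : J m z -> J n z -> (n <= m)%N.
  case: m n => [//|m] [//|n] [offz _ zm] [_ nz _].
  have nm : jump (t n.+1) (b m) := thru_trans nz offz zm.
  have := tmax _ _ _ (bt m) nm; rewrite leqNgt => tnm.
  by rewrite leqNgt; apply/negP => mn; case/negP: tnm; apply: leq_trans (t_le _ _ mn).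
pose Sout n := segment b n `|` J n.
have bseg n : segment b n (v (b n)) by exists (b n) => //=; rewrite leqnn b_lt.
have tseg n : segment b n (v (t n)) by exists (t n) => //=; rewrite bt tb.
have SoutE n z : ([set v (b n)] `|` Sout n) z -> Sout n z.
  by case=> // ->; left.
have seg_off n z : segment b n z -> off z -> False by case=> k _ <- /off_v.
exists (fun n => v (b n)), (fun n => [set v (b n)]), Sout; split.
- move=> n; apply/seteqP; split=> z /=; first by case.
  by move=> ->; split=> //; left.
- by move=> n z; left.
- move=> n z [[k bk <-]|].
    case: (segment_thru bk) => [->|bkE]; [by left|right].
    by apply: thru_sub bkE => w; left.
  (* The root reaches [z] along the ray up to the tail of the jump, then through the interior of the
     jump. *)
  case: n => [//|n] [offz tz zb]; right.
  have {}tz : thru E (Sout n.+1) (v (t n.+1)) z.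
    apply: thru_sub (thru_interior tz) => w [offw tw wz]; right; split=> //.
    exact: thru_trans wz offz zb.
  have tk : (b n.+1 <= t n.+1 < b n.+2)%N by rewrite bt tb.
  case: (segment_thru tk) => [<- //|btE].
  apply: thru_trans tz; last by left.
  by apply: thru_sub btE => w; left.
- move=> m n z /SoutE[mz|mz] /SoutE[nz|nz].
  + exact: segment_inj mz nz.
  + by case: (seg_off _ _ mz (Joff _ _ nz)).
  + by case: (seg_off _ _ nz (Joff _ _ mz)).
  + by apply/eqP; rewrite eqn_leq (J_le _ _ _ mz nz) (J_le _ _ _ nz mz).
- move=> m n [->|->].
    have [x mx xm] := segment_step (b_lt m); exists x, (v (b m.+1)).
    by split=> //; left.
  case: (thru_last (tjump n)) => [tbE|[z [offz tz zb]]].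
    by exists (v (t n.+1)), (v (b n)); split=> //; left.
  by exists z, (v (b n)); split=> //; right; split=> //; exact: thru1.
Qed.

Lemma out_ray_model : (forall n, thru E setT (v n.+1) (v 0)) ->
  has_model double_ray_arc E \/ has_model dominated_ray_arc E.
Proof.
move=> back.
have [[h hinf]|nh] :=
    pselect (exists h, forall N, exists t, (N <= t)%N /\ jump t h).
  by right; exact: dominated_model hinf.
left; apply: double_ray_model => // h; apply/not_existsP => hN.
apply: nh; exists h => N; apply/not_existsP => Nt; apply: (hN N) => t th.
by rewrite leqNgt; apply/negP => /ltnW ?; apply: (Nt t).
Qed.

End OutRay.

(** * Fans *)

Lemma infinite_sub_bigcup (I T : Type) (A B : set T) (D : set I) (F : I -> set T) :
  infinite_set A -> finite_set B -> (forall i, D i -> finite_set (F i)) ->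
  A `<=` B `|` \bigcup_(i in D) F i -> infinite_set D.
Proof.
move=> Ainf Bfin Ffin AF Dfin; apply: Ainf; apply: sub_finite_set AF _.
by rewrite finite_setU; split=> //; exact: bigcup_finite.
Qed.

Section Fan.
Variables (V : eqType) (E : V -> V -> Prop) (U : set V) (c : V).

Definition outside (s : seq V) : set V := [set z | z \notin s].

Lemma outside_nil : outside [::] = setT.
Proof. by apply/seteqP. Qed.

Definition targets s x : set V := U `&` [set u | reach E (outside s) x u].

(** A stage of Koenig's argument: [sx.1] lists the vertices passed, latest first, and [sx.2] is the
    current end. As the vertices passed reach the end within the stem, a final stem can serve as a
    branch set. *)
Definition stem (sx : seq V * V) :=
  [/\ c \in sx.2 :: sx.1,
      forall z, z \in sx.1 -> thru E [set` sx.2 :: sx.1] z sx.2 &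
      infinite_set (targets sx.1 sx.2)].

Lemma stem_notin sx : stem sx -> sx.2 \notin sx.1.
Proof.
case=> _ _ inf; apply: contrapT => xs; apply: inf.
by rewrite (_ : targets _ _ = set0) //; apply/seteqP; split=> // z [_ []].
Qed.

(** After its last visit to [x], a walk to another target enters an out-neighbour of [x] and avoids
    [x :: s] from then on. So infinitely many targets either leave infinitely many to one
    out-neighbour or need infinitely many out-neighbours. *)
Lemma targets_step s x : targets s x `<=` [set x] `|`
  \bigcup_(y in [set y | E x y /\ y \notin x :: s]) targets (x :: s) y.
Proof.
move=> u [Uu xu]; case: (reach_head xu) => [->|[y [xy ys yu]]]; [by left|right].
have sxE : outside s `\ x = outside (x :: s).
  apply/seteqP; split=> z /=; rewrite /outside /= inE negb_or.
    by case=> -> /eqP ->.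
  by move=> /andP[/eqP zx ->].
by rewrite sxE in ys yu; exists y.
Qed.

(* Koenig: extend a path from c as long as infinitely many elements of U stay
   reachable from its end x without meeting its earlier vertices s. *)
Lemma ray_or_fan : infinite_set (targets [::] c) ->
  (exists v : nat -> V, injective v /\ forall n, E (v n) (v n.+1)) \/
  exists s x, stem (s, x) /\
    forall y, E x y -> y \notin x :: s -> finite_set (targets (x :: s) y).
Proof.
move=> cinf.
have [|nfan] := pselect (exists s x, stem (s, x) /\
    forall y, E x y -> y \notin x :: s -> finite_set (targets (x :: s) y)).
  by right.
left.
(* Without a fan, some out-neighbour keeps infinitely many targets and extends the stem; the default
   [x] only makes the choice total. *)
have step sx : exists y, stem sx ->
    [/\ E sx.2 y, y \notin sx.2 :: sx.1 & stem (sx.2 :: sx.1, y)].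
  case: sx => s x; have [st|] := pselect (stem (s, x)); last by exists x.
  apply: contrapT => /forallNP ny; apply: nfan; exists s, x; split=> // y xy yxs.
  apply: contrapT => yinf; apply: (ny y) => _; split=> //; split=> //=.
    by case: st => /= cx _ _; rewrite inE cx orbT.
  move=> z zxs; have xE : thru E [set` y :: x :: s] x y by exact: thru1.
  move: zxs; rewrite inE => /predU1P[->//|zs].
  have [_ /(_ _ zs) zx _] := st; apply: thru_trans xE.
    by apply: thru_sub zx => w /=; rewrite !inE => ->; rewrite orbT.
  by rewrite /= !inE eqxx orbT.
have [f fP] := choice step.
pose st n := iter n (fun sx => (sx.2 :: sx.1, f sx)) ([::], c).
have stP n : stem (st n).
  by elim: n => [|n /fP[]//]; split=> //=; rewrite inE.
pose v n := (st n).2.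
(* Passed vertices stay listed, while the end of a stem is never listed: this gives injectivity. *)
have v_mem m n : (m < n)%N -> v m \in (st n).1.
  elim: n => // n IH; rewrite ltnS leq_eqVlt => /predU1P[->|mn] /=.
    exact: mem_head.
  by rewrite inE IH ?orbT.
have v_neq m n : (m < n)%N -> v m <> v n.
  by move=> /v_mem + mn; rewrite mn; apply/negP; exact: (stem_notin (stP n)).
exists v; split=> [m n mn|n]; last by case: (fP _ (stP n)).
by case: (ltngtP m n) => // /v_neq; rewrite mn.
Qed.

End Fan.

(** Greedy choice: the sets [F] of the earlier terms cover only finitely many elements, so [A]
    always has one left. *)
Lemma free_sequence (T : Type) (A : set T) (F : T -> set T) :
  infinite_set A -> (forall a, A a -> finite_set (F a)) ->
  exists f : nat -> T, (forall n, A (f n)) /\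
    forall m n, (m < n)%N -> ~ F (f m) (f n).
Proof.
move=> Ainf Ffin.
have step (B : set T) : exists a, finite_set B -> A a /\ ~ B a.
  have [Bfin|nB] := pselect (finite_set B); last first.
    by have [a _] := infinite_setN0 Ainf; exists a.
  have [a [Aa Ba]] := infinite_setN0 (infinite_setD Ainf Bfin).
  by exists a.
have [g gP] := choice step.
pose B n := iter n (fun B => B `|` F (g B)) set0.
have Bfin n : finite_set (B n).
  elim: n => [|n IH] /=; first exact: finite_set0.
  by rewrite finite_setU; split=> //; apply: Ffin; case: (gP _ IH).
exists (fun n => g (B n)); split=> [n|m n mn Fmn]; first by case: (gP _ (Bfin n)).
have FB : F (g (B m)) `<=` B n.
  elim: n mn {Fmn} => // n IH; rewrite ltnS leq_eqVlt => /predU1P[<-|/IH mn] z Fz.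
    by right.
  by left; exact: mn.
by have [_] := gP _ (Bfin n); apply; exact: FB.
Qed.

(** * Infinite out-degree and the star *)

Definition star_arc (m n : option nat) := (m == None) != (n == None).

Section Star.
Variables (V : eqType) (E : V -> V -> Prop).

(** When Koenig's path gets stuck at [x], its infinitely many targets are split among out-neighbours
    with finitely many each. *)
Lemma infinite_degree c0 : infinite_set (targets E setT [::] c0) ->
  (exists v : nat -> V, injective v /\ forall n, E (v n) (v n.+1)) \/
  exists c, infinite_set [set u | E c u].
Proof.
move=> c0inf; case: (ray_or_fan c0inf) => [|[s [x [[_ _ xinf] fin]]]];
  [by left|right; exists x].
have : infinite_set [set y | E x y /\ y \notin x :: s].
  apply: infinite_sub_bigcup xinf (finite_set1 x) _ (@targets_step _ _ _ _ _).
  by move=> y [xy]; exact: fin xy.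
by apply: sub_infinite_set => y [].
Qed.

(** Koenig's argument runs on [flip E] with the out-neighbours of [c] as targets. A stuck stem
    contains [c] and is reached in [E] from its end [x]: it is the centre, receiving arcs at [x] and
    sending them from [c]. *)
Lemma star_model c : infinite_set [set u | E c u] -> (forall u, E c u -> reach E setT u c) ->
  (exists v : nat -> V, injective v /\ forall n, E (v n.+1) (v n)) \/
  has_model star_arc E.
Proof.
set U := [set u | E c u] => Uinf to_c.
have cinf : infinite_set (targets (flip E) U [::] c).
  apply: sub_infinite_set Uinf => u Uu; split=> //=; rewrite outside_nil.
  exact: reach_flip (to_c _ Uu).
case: (ray_or_fan cinf) => [|[s [x [sx fin]]]]; [by left|right].
pose G := outside (x :: s).
have xs : x \notin s := stem_notin sx.
case: sx => /= cx stemx xinf.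
pose A := [set u | exists y, [/\ E y x, G y & targets (flip E) U (x :: s) y u]].
have Ainf : infinite_set A.
  apply: sub_infinite_set (infinite_setD xinf (finite_set1 x)) => u [].
  by move=> /targets_step[|[y [yx ys] yu] _]; last by exists y.
have exy u : exists y, A u ->
    [/\ E y x, G y & targets (flip E) U (x :: s) y u].
  by have [[z zP]|nA] := pselect (A u); [exists z|exists u].
have [y yP] := choice exy.
have [a /yP[yx ys _]|f [fA ffree]] := @free_sequence _ A
    (fun a => targets (flip E) U (x :: s) (y a)) Ainf.
  exact: fin.
pose leaf n : set V := [set z | reach E G (f n) z /\ reach E G z (y (f n))].
(* A vertex common to leaves [m < n] would let [f n] reach [y (f m)], making [f n] a target of
   [y (f m)], which the free sequence excludes. *)
have leaf_le m n z : leaf m z -> leaf n z -> (n <= m)%N.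
  move=> [_ zm] [nz _]; rewrite leqNgt; apply/negP => /ffree; apply.
  by have [_ _ []] := yP _ (fA n); split=> //; exact: reach_flip (reach_trans nz zm).
have fG n : reach E G (f n) (y (f n)).
  by have [_ _ [_ yf]] := yP _ (fA n); exact: reach_flip yf.
have f_leaf n : leaf n (f n) by split=> //; split; [case: (fG n)|case: (fG n)|left].
have y_leaf n : leaf n (y (f n)) by split=> //; split; [case: (fG n)|case: (fG n)|left].
have leaf_off n z : leaf n z -> z \notin x :: s by case=> -[].
pose rt w := if w is Some n then f n else x.
pose Sout w := if w is Some n then leaf n else [set` x :: s].
have rt_out w : Sout w (rt w) by case: w => //=; exact: mem_head.
have SoutE w z : ([set rt w] `|` Sout w) z -> Sout w z by case=> // ->.
exists rt, (fun w => [set rt w]), Sout; split.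
- by move=> w; apply/seteqP; split=> z /=; [case|move=> ->].
- by move=> w z; left.
- move=> [n|] z /=.
    case=> -[_ Gz [->|fz] zy]; [by left|right].
    apply: thru_sub (thru_interior fz) => w [Gw fw wz].
    split; first by split=> //; [case: (fG n)|right].
    by apply: reach_trans zy; split=> //; right.
  rewrite inE => /predU1P[->|zs]; [by left|right].
  exact: thru_flip (stemx _ zs).
- move=> [m|] [n|] z /SoutE mz /SoutE nz //.
  + by congr Some; apply/eqP; rewrite eqn_leq (leaf_le _ _ _ mz nz) (leaf_le _ _ _ nz mz).
  + by move: (leaf_off _ _ mz); rewrite [z \in _]nz.
  + by move: (leaf_off _ _ nz); rewrite [z \in _]mz.
- move=> [m|] [n|] //= _; last first.
    by exists c, (f n); split=> //; have [_ _ []] := yP _ (fA n).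
  by exists (y (f m)), x; split=> //; have [] := yP _ (fA m).
Qed.

End Star.

(** * The three minors *)

Definition double_ray_adj : set (nat * nat) :=
  range (fun n => (n, n.+1)) `|` range (fun n => (n.+1, n)).

Lemma double_ray_sym m n : double_ray_adj (m, n) -> double_ray_adj (n, m).
Proof. by case=> -[k _ [<- <-]]; [right|left]; exists k. Qed.

Lemma double_ray_vertices m n :
  double_ray_adj (m, n) -> [set: nat] m /\ [set: nat] n.
Proof. by []. Qed.

Definition nat_ray : ugraph nat := UGraph double_ray_sym double_ray_vertices.

Lemma nat_ray_is_ray : is_ray nat_ray.
Proof.
exists id; split=> //; apply/seteqP; split=> // n _; by exists n.
Qed.

(** With [predn] as parent map and [id] as rank, the general tree construction yields both rays; the
    form is that of [par_in]. *)
Lemma pred_parent n : [set: nat] n -> n <> 0 -> [set: nat] n.-1 /\ (id n.-1 < id n)%N.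
Proof. by case: n. Qed.

Definition nat_in_ray : digraph nat := in_tree (r := 0) pred_parent.
Definition nat_out_ray : digraph nat := out_tree (r := 0) pred_parent.

Lemma nat_childE m n : child setT 0 predn m n <-> m = n.+1.
Proof. by split=> [[_]|->]; [case: m => // m _ ->|split]. Qed.

Lemma nat_tree_adj : tree_adj setT 0 predn = double_ray_adj.
Proof.
apply/seteqP; split=> -[m n] /=.
  by case=> /= /nat_childE ->; [right|left]; eexists.
by case=> -[k _ [<- <-]]; [right|left]; apply/nat_childE.
Qed.

Lemma nat_tree_ray (R : digraph nat) : vertices R = setT ->
  adj (underlying R) = double_ray_adj ->
  is_ray (underlying R) /\ degree_one (underlying R) 0.
Proof.
move=> RV RA; split.
  exists id; split=> //.
  by rewrite [LHS]RV; apply/seteqP; split=> // n _; exists n.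
exists 1; rewrite RA; split; first by left; exists 0.
by move=> n [] [k _ []] // -> <-.
Qed.

Lemma nat_in_rayP : in_ray nat_in_ray 0.
Proof.
have [] : is_ray (underlying nat_in_ray) /\ degree_one (underlying nat_in_ray) 0.
  by apply: nat_tree_ray; rewrite ?adj_in_tree ?nat_tree_adj.
by split=> //; exact: in_tree_arborescence.
Qed.

Lemma nat_out_rayP : out_ray nat_out_ray 0.
Proof.
have [] : is_ray (underlying nat_out_ray) /\ degree_one (underlying nat_out_ray) 0.
  by apply: nat_tree_ray; rewrite ?adj_out_tree ?nat_tree_adj.
by split=> //; exact: out_tree_arborescence.
Qed.

Definition total_digraph (W : eqType) (A : set (W * W)) : digraph W :=
  @Digraph W setT A (fun _ _ _ => conj I I).

Definition dominated_out_ray : digraph nat :=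
  total_digraph (arcs nat_out_ray `|` [set (n, 0) | n in [set: nat] `\ 0]).

Definition dominated_in_ray : digraph nat :=
  total_digraph (arcs nat_in_ray `|` [set (0, n) | n in [set: nat] `\ 0]).

Section Minors.
Variables (V : eqType) (D : digraph V).
Let E x y := arcs D (x, y).

Lemma star_minor : has_model star_arc E ->
  butterfly_minor (bidirected infinite_star) D.
Proof.
apply: has_model_butterfly => [[n|]|u v].
- by exists None; right; exists n.
- by exists (Some 0); left; exists 0.
- by case=> -[n _ [<- <-]].
Qed.

Lemma double_ray_minor : has_model double_ray_arc E ->
  butterfly_minor (bidirected nat_ray) D.
Proof.
apply: has_model_butterfly => [n|m n]; first by exists n.+1; left; exists n.
by case=> -[k _ [<- <-]]; [left|right].
Qed.

Lemma dominated_out_ray_minor : has_model dominated_ray_arc E ->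
  butterfly_minor dominated_out_ray D.
Proof.
apply: has_model_butterfly => [n|m n].
  by exists n.+1; left; apply/nat_childE.
by case=> /= [/nat_childE ->|[k [_ k0] [<- <-]]]; [left|right].
Qed.

Lemma dominated_in_ray_minor : has_model (flip dominated_ray_arc) E ->
  butterfly_minor dominated_in_ray D.
Proof.
apply: has_model_butterfly => [[|n]|m n].
- by exists 1; right; exists 1.
- by exists n; left; apply/nat_childE.
- by case=> /= [/nat_childE ->|[k [_ k0] [<- <-]]]; [left|right].
Qed.

Lemma is_path_thru p x y : is_path (arcs D) x p y -> x = y \/ thru E setT x y.
Proof.
case=> + _ <-; elim: p x => [|z p IH] x /=; first by left.
move=> /andP[/set_mem xz /IH zp]; right.
by case: zp => [<-|zp]; [exact: thru1|exact: thruS xz _ zp].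
Qed.

End Minors.

Theorem corollary1p4 (V : eqType) (D : digraph V)
    (Dinf : infinite_set (vertices D)) (Dsc : strongly_connected D) :
  butterfly_minor (bidirected infinite_star) D \/
  (exists (W : eqType) (R : ugraph W),
     is_ray R /\ butterfly_minor (bidirected R) D) \/
  (exists (W : eqType) (H : digraph W),
     dominated_directed_ray H /\ butterfly_minor H D).
Proof.
pose E x y := arcs D (x, y).
have conn x y : vertices D x -> vertices D y -> reach E setT x y.
  by move=> Dx Dy; have [p /is_path_thru] := Dsc _ _ Dx Dy.
have thru_of x y : vertices D x -> vertices D y -> x <> y -> thru E setT x y.
  by move=> Dx Dy xy; case: (conn _ _ Dx Dy) => _ _ [].
have [[v [v_inj v_arc]]|no_out] :=
    pselect (exists v : nat -> V, injective v /\ forall n, E (v n) (v n.+1)).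
  have Dv n : vertices D (v n) by case: (arcs_vertices (v_arc n)).
  have back n : thru E setT (v n.+1) (v 0) by apply: thru_of => // /v_inj.
  right; case: (out_ray_model v_inj v_arc back) => [m|m]; [left|right].
    exists nat, nat_ray; split; first exact: nat_ray_is_ray.
    exact: double_ray_minor.
  exists nat, dominated_out_ray; split; last exact: dominated_out_ray_minor.
  by exists nat_out_ray, 0; split=> //; left; split=> //; exact: nat_out_rayP.
(* There is no out-ray, so Koenig's argument from any vertex, with all vertices as targets, yields
   one of infinite out-degree. *)
have [c0 Dc0] := infinite_setN0 Dinf.
have c0inf : infinite_set (targets E setT [::] c0).
  by apply: sub_infinite_set Dinf => u Du; split=> //=; rewrite outside_nil; exact: conn.
have [//|[c cinf]] := infinite_degree c0inf.
have [u cu] := infinite_setN0 cinf.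
have Dc : vertices D c by case: (arcs_vertices cu).
have to_c w : E c w -> reach E setT w c.
  by move=> /arcs_vertices[_ Dw]; exact: conn.
have [[v [v_inj v_arc]]|m] := star_model cinf to_c; last by left; exact: star_minor.
have Dv n : vertices D (v n) by case: (arcs_vertices (v_arc n)).
have back n : thru (flip E) setT (v n.+1) (v 0).
  by apply/thru_flip/thru_of => // /v_inj.
(* The in-ray is an out-ray of the reversed digraph; the model found there is reversed back. *)
right; case: (out_ray_model (E := flip E) v_inj v_arc back) => /has_model_flip m.
  left; exists nat, nat_ray; split; first exact: nat_ray_is_ray.
  apply: double_ray_minor; move: m; congr has_model.
  (* The double ray relation is symmetric, hence invariant under reversal. *)
  by apply/funext => i; apply/funext => j; apply/propext; split=> -[]; [right|left|right|left].
right; exists nat, dominated_in_ray; split; last exact: dominated_in_ray_minor.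
by exists nat_in_ray, 0; split=> //; right; split=> //; exact: nat_in_rayP.
Qed.
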